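(* Let $\gamma_1,\gamma_2\in\mathbb{R}\setminus\{0\}$, let $f:\mathbb{H}(\gamma_1,\gamma_2)\to\mathbb{H}(\gamma_1,\gamma_2)$ be a continuous function, and let $F$ (the isomorphism onto $\mathbb{H}(1,1)$ or $\mathbb{H}(1,-1)$ determined by the signs of $\gamma_1,\gamma_2$) and $\mathfrak{F}f$ be as defined in the context. Let $x^0\in\mathbb{H}(\gamma_1,\gamma_2)$. If $x^0$ is a root of the equation $f(x)=0$ in $\mathbb{H}(\gamma_1,\gamma_2)$, then $F(x^0)$ is a root of the equation $\mathfrak{F}f(F(x))=0$ in $\mathbb{H}(1,1)$ or $\mathbb{H}(1,-1)$ (depending on the signs of $\gamma_1$ and $\gamma_2$), that is, $\mathfrak{F}f(F(x^0))=0$. Conversely, if $F(x^0)$ is a root of the equation $\mathfrak{F}f(F(x))=0$, then $x^0$ is a root of $f(x)=0$.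
   Context: For $\gamma_1,\gamma_2\in\mathbb{R}\setminus\{0\}$, the generalized quaternion algebra $\mathbb{H}(\gamma_1,\gamma_2)$ is the associative unital real algebra with basis $\{1,e_1,e_2,e_3\}$ and multiplication $e_1^2=-\gamma_1$, $e_2^2=-\gamma_2$, $e_3^2=-\gamma_1\gamma_2$, $e_1e_2=-e_2e_1=e_3$, $e_2e_3=-e_3e_2=\gamma_2e_1$, $e_3e_1=-e_1e_3=\gamma_1e_2$. The canonical basis of $\mathbb{H}(1,1)$ is written $1,i,j,k$ and that of $\mathbb{H}(1,-1)$ is written $1,i_1,i_2,i_3$. These spaces carry their usual topology as 4-dimensional real vector spaces. $F$ is the $\mathbb{R}$-linear bijection with $F(1)=1$ given as follows: if $\gamma_1,\gamma_2>0$, $F=A:\mathbb{H}(\gamma_1,\gamma_2)\to\mathbb{H}(1,1)$, $e_1\mapsto\sqrt{\gamma_1}\,i$, $e_2\mapsto\sqrt{\gamma_2}\,j$, $e_3\mapsto\sqrt{\gamma_1\gamma_2}\,k$; if $\gamma_1,\gamma_2<0$, $F=B:\mathbb{H}(\gamma_1,\gamma_2)\to\mathbb{H}(1,-1)$, $e_1\mapsto\sqrt{-\gamma_1}\,i_3$, $e_2\mapsto\sqrt{-\gamma_2}\,i_2$, $e_3\mapsto\sqrt{\gamma_1\gamma_2}\,i_1$; if $\gamma_1>0,\gamma_2<0$, $F=C:\mathbb{H}(\gamma_1,\gamma_2)\to\mathbb{H}(1,-1)$, $e_1\mapsto\sqrt{\gamma_1}\,i_1$, $e_2\mapsto\sqrt{-\gamma_2}\,i_2$,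 $e_3\mapsto\sqrt{-\gamma_1\gamma_2}\,i_3$; if $\gamma_1<0,\gamma_2>0$, $F=D:\mathbb{H}(\gamma_1,\gamma_2)\to\mathbb{H}(1,-1)$, $e_1\mapsto\sqrt{-\gamma_1}\,i_3$, $e_2\mapsto\sqrt{\gamma_2}\,i_1$, $e_3\mapsto\sqrt{-\gamma_1\gamma_2}\,i_2$. Write a continuous $f$ as $f(x)=f_0(x_0,x_1,x_2,x_3)+\sum_{\ell=1}^3 f_\ell(x_0,x_1,x_2,x_3)e_\ell$ for $x=x_0+x_1e_1+x_2e_2+x_3e_3$, with real-valued $f_\ell$. The function $\mathfrak{F}f$, defined on and taking values in the target algebra of $F$, is $\mathfrak{F}f:=f_0+f_1F(e_1)+f_2F(e_2)+f_3F(e_3)$, where, at the point $F(x)$, the functions $f_\ell$ are evaluated at the coordinates $(x_0,x_1,x_2,x_3)$ of $x$; i.e. $\mathfrak{F}f(F(x))=f_0(x_0,\dots,x_3)+\sum_{\ell=1}^3f_\ell(x_0,\dots,x_3)F(e_\ell)$. *)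

(* Defs.v *)
From HB Require Import structures.
From mathcomp Require Import all_boot all_order all_algebra.
From mathcomp Require Import ring.
From mathcomp Require Import all_classical all_reals all_analysis.

Set Implicit Arguments.
Unset Strict Implicit.
Unset Printing Implicit Defensive.

Import Order.TTheory GRing.Theory Num.Theory.
Import numFieldNormedType.Exports.

Local Open Scope classical_set_scope.
Local Open Scope ring_scope.

(* H(g1, g2), on the space of coordinates in the basis 1, e_1, e_2, e_3; the
   parameters g1, g2 are phantoms that select the multiplication below. *)
Definition quat (R : realType) (g1 g2 : R) : Type := 'rV[R]_4.

HB.instance Definition _ (R : realType) (g1 g2 : R) :=
  NormedModule.on (quat g1 g2).

Section QuatAlgebra.
Variables (R : realType) (g1 g2 : R).
Local Notation H := (quat g1 g2).

Definition qcoord (l : 'I_4) (x : H) : R := (x : 'rV[R]_4) 0 l.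

Definition qe (l : 'I_4) : H := delta_mx 0 l.

Definition qmk (a b c d : R) : H := \row_(l < 4) [:: a; b; c; d]`_l.

Definition qmul (x y : H) : H :=
  let: (x0, x1, x2, x3) := (qcoord 0 x, qcoord 1 x, qcoord 2 x, qcoord 3 x) in
  let: (y0, y1, y2, y3) := (qcoord 0 y, qcoord 1 y, qcoord 2 y, qcoord 3 y) in
  qmk (x0 * y0 - g1 * (x1 * y1) - g2 * (x2 * y2) - g1 * g2 * (x3 * y3))
      (x0 * y1 + x1 * y0 + g2 * (x2 * y3 - x3 * y2))
      (x0 * y2 + x2 * y0 + g1 * (x3 * y1 - x1 * y3))
      (x0 * y3 + x3 * y0 + (x1 * y2 - x2 * y1)).

Lemma quatP (x y : H) :
  [/\ qcoord 0 x = qcoord 0 y, qcoord 1 x = qcoord 1 y,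
      qcoord 2 x = qcoord 2 y & qcoord 3 x = qcoord 3 y] -> x = y.
Proof.
case=> h0 h1 h2 h3; apply/rowP => -[[|[|[|[|//]]]] i].
- by rewrite (_ : Ordinal i = 0) //; apply/val_inj.
- by rewrite (_ : Ordinal i = 1) //; apply/val_inj.
- by rewrite (_ : Ordinal i = 2) //; apply/val_inj.
- by rewrite (_ : Ordinal i = 3) //; apply/val_inj.
Qed.

Lemma qcoord_mk (a b c d : R) :
  (qcoord 0 (qmk a b c d) = a) * (qcoord 1 (qmk a b c d) = b) *
  (qcoord 2 (qmk a b c d) = c) * (qcoord 3 (qmk a b c d) = d).
Proof. by rewrite /qcoord !mxE. Qed.

Lemma qcoordD l (x y : H) : qcoord l (x + y) = qcoord l x + qcoord l y.
Proof. by rewrite /qcoord mxE. Qed.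

Lemma qcoordN l (x : H) : qcoord l (- x) = - qcoord l x.
Proof. by rewrite /qcoord mxE. Qed.

Lemma qcoordZ l (a : R) (x : H) : qcoord l (a *: x) = a * qcoord l x.
Proof. by rewrite /qcoord mxE. Qed.

Lemma qcoord_qe l m : qcoord l (qe m) = (l == m)%:R.
Proof. by rewrite /qcoord mxE. Qed.

Definition qcoordE := (qcoord_mk, qcoordD, qcoordN, qcoordZ, qcoord_qe).

Lemma qmulA : associative qmul.
Proof. by move=> x y z; apply/quatP; rewrite /qmul !qcoordE; split; ring. Qed.

Lemma qmul1q : left_id (qe 0) qmul.
Proof. by move=> x; apply/quatP; rewrite /qmul !qcoordE /=; split; ring. Qed.

Lemma qmulq1 : right_id (qe 0) qmul.
Proof. by move=> x; apply/quatP; rewrite /qmul !qcoordE /=; split; ring. Qed.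

Lemma qmulDl : left_distributive qmul +%R.
Proof. by move=> x y z; apply/quatP; rewrite /qmul !qcoordE; split; ring. Qed.

Lemma qmulDr : right_distributive qmul +%R.
Proof. by move=> x y z; apply/quatP; rewrite /qmul !qcoordE; split; ring. Qed.

Lemma qone_neq0 : qe 0 != 0.
Proof.
apply/eqP => /(congr1 (qcoord 0)) /eqP.
by rewrite qcoord_qe eqxx /qcoord mxE oner_eq0.
Qed.

HB.instance Definition _ := GRing.Zmodule_isNzRing.Build H
  qmulA qmul1q qmulq1 qmulDl qmulDr qone_neq0.

Lemma qmulE (x y : H) : x * y = qmul x y. Proof. by []. Qed.

Lemma qoneE : 1 = qe 0 :> H. Proof. by []. Qed.

Lemma qscaleAl (a : R) (x y : H) : a *: (x * y) = a *: x * y.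
Proof. by apply/quatP; rewrite !qmulE /qmul !qcoordE; split; ring. Qed.

HB.instance Definition _ := GRing.Lmodule_isLalgebra.Build R H qscaleAl.

Lemma qscaleAr (a : R) (x y : H) : a *: (x * y) = x * (a *: y).
Proof. by apply/quatP; rewrite !qmulE /qmul !qcoordE; split; ring. Qed.

HB.instance Definition _ := GRing.Lalgebra_isAlgebra.Build R H qscaleAr.

End QuatAlgebra.

Arguments qe {R g1 g2} l.
Arguments qcoord {R g1 g2} l x.

Lemma qe_table (R : realType) (g1 g2 : R) :
  [/\ qe 0 = 1 :> quat g1 g2,
      [/\ qe 1 * qe 1 = (- g1)%:A :> quat g1 g2,
          qe 2 * qe 2 = (- g2)%:A :> quat g1 g2 &
          qe 3 * qe 3 = (- (g1 * g2))%:A :> quat g1 g2],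
      qe 1 * qe 2 = qe 3 :> quat g1 g2 /\ - (qe 2 * qe 1) = qe 3 :> quat g1 g2,
      qe 2 * qe 3 = g2 *: qe 1 :> quat g1 g2 /\
        - (qe 3 * qe 2) = g2 *: qe 1 :> quat g1 g2 &
      qe 3 * qe 1 = g1 *: qe 2 :> quat g1 g2 /\
        - (qe 1 * qe 3) = g1 *: qe 2 :> quat g1 g2].
Proof.
by do ![split]; apply/quatP;
  rewrite ?qmulE ?qoneE /qmul !qcoordE /=; split; ring.
Qed.

Section CanonicalMaps.
Variables (R : realType) (g1 g2 : R).

Definition mapA (x : quat g1 g2) : quat (1 : R) 1 :=
  qcoord 0 x *: 1
  + qcoord 1 x *: (Num.sqrt g1 *: qe 1)
  + qcoord 2 x *: (Num.sqrt g2 *: qe 2)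
  + qcoord 3 x *: (Num.sqrt (g1 * g2) *: qe 3).

Definition mapB (x : quat g1 g2) : quat (1 : R) (-1) :=
  qcoord 0 x *: 1
  + qcoord 1 x *: (Num.sqrt (- g1) *: qe 3)
  + qcoord 2 x *: (Num.sqrt (- g2) *: qe 2)
  + qcoord 3 x *: (Num.sqrt (g1 * g2) *: qe 1).

Definition mapC (x : quat g1 g2) : quat (1 : R) (-1) :=
  qcoord 0 x *: 1
  + qcoord 1 x *: (Num.sqrt g1 *: qe 1)
  + qcoord 2 x *: (Num.sqrt (- g2) *: qe 2)
  + qcoord 3 x *: (Num.sqrt (- (g1 * g2)) *: qe 3).

Definition mapD (x : quat g1 g2) : quat (1 : R) (-1) :=
  qcoord 0 x *: 1
  + qcoord 1 x *: (Num.sqrt (- g1) *: qe 3)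
  + qcoord 2 x *: (Num.sqrt g2 *: qe 1)
  + qcoord 3 x *: (Num.sqrt (- (g1 * g2)) *: qe 2).

Definition target_sign : R := if (0 < g1) && (0 < g2) then 1 else -1.

(* For nonzero g1, g2 the last two branches are 0 < g1, g2 < 0 and
   g1 < 0, 0 < g2. *)
Definition mapF : quat g1 g2 -> quat 1 target_sign :=
  if (0 < g1) && (0 < g2) as b
    return quat g1 g2 -> quat (1 : R) (if b then 1 else -1)
  then mapA
  else if (g1 < 0) && (g2 < 0) then mapB
  else if 0 < g1 then mapC
  else mapD.

(* For nonzero g1, g2, mapF is bijective and pinv setT mapF is its inverse, so
   the components of f are evaluated at the point x such that mapF x = y. *)
Definition frakF (f : quat g1 g2 -> quat g1 g2) (y : quat 1 target_sign) :
    quat 1 target_sign :=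
  let x := pinv setT mapF y in
  qcoord 0 (f x) *: 1
  + qcoord 1 (f x) *: mapF (qe 1)
  + qcoord 2 (f x) *: mapF (qe 2)
  + qcoord 3 (f x) *: mapF (qe 3).

End CanonicalMaps.

(* Main.v *)
Require Import Defs.
From mathcomp Require Import all_boot all_order all_algebra.
From mathcomp Require Import all_classical all_reals all_analysis.

Import Order.TTheory GRing.Theory Num.Theory.
Import numFieldNormedType.Exports.

Local Open Scope ring_scope.

(** In every sign case [mapF] sends the units [e_1], [e_2], [e_3] to nonzero
    multiples of the units of the target algebra, in some order
    ([mapF_monomial]); hence it is injective ([mapF_inj]) and determined by
    its values on the basis ([mapF_basis]).  By injectivity, the point at which
    [frakF f (mapF x)] evaluates the components of [f] is [x] itself, so
    [frakF f] is the transport of [f] along [mapF]: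
    [frakF f (mapF x) = mapF (f x)] ([frakF_mapF]).  Both implications then say
    that the injective map [mapF], which vanishes at [0], vanishes nowhere
    else. *)

(** The common shape of [mapA], [mapB], [mapC], [mapD]: the linear map that
    fixes the unit and sends [e_l] to [u_l]. *)
Definition qcomb {R : realType} {g1 g2 h1 h2 : R} (u1 u2 u3 : quat h1 h2)
    (x : quat g1 g2) : quat h1 h2 :=
  qcoord 0 x *: 1 + qcoord 1 x *: u1 + qcoord 2 x *: u2 + qcoord 3 x *: u3.

Lemma qcomb0 (R : realType) (g1 g2 h1 h2 : R) (u1 u2 u3 : quat h1 h2) :
  qcomb u1 u2 u3 (0 : quat g1 g2) = 0.
Proof. by rewrite /qcomb /qcoord !mxE !scale0r !addr0. Qed.

Lemma qcomb_qe (R : realType) (g1 g2 h1 h2 : R) (u1 u2 u3 : quat h1 h2) :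
  [/\ qcomb u1 u2 u3 (qe 1 : quat g1 g2) = u1,
      qcomb u1 u2 u3 (qe 2 : quat g1 g2) = u2 &
      qcomb u1 u2 u3 (qe 3 : quat g1 g2) = u3].
Proof.
by split; rewrite /qcomb !qcoord_qe /= !scale0r scale1r ?addr0 ?add0r.
Qed.

(** Each coordinate of the image is, up to a nonzero factor, exactly one
    coordinate of the argument, which can therefore be read off. *)
Lemma qcomb_monomial_inj (R : realType) (g1 g2 h1 h2 : R) (l1 l2 l3 : 'I_4)
    (a1 a2 a3 : R) :
  uniq [:: 0; l1; l2; l3] -> [&& a1 != 0, a2 != 0 & a3 != 0] ->
  injective (@qcomb R g1 g2 h1 h2 (a1 *: qe l1) (a2 *: qe l2) (a3 *: qe l3)).
Proof.
rewrite /= !inE !negb_or => /and4P[/and3P[n01 n02 n03] /andP[n12 n13] n23 _].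
case/and3P=> a1N0 a2N0 a3N0 x y exy.
have E m := congr1 (qcoord m) exy.
move: (E 0) (E l1) (E l2) (E l3).
rewrite /qcomb qoneE !qcoordE !eqxx.
rewrite ![l1 == 0]eq_sym ![l2 == 0]eq_sym ![l3 == 0]eq_sym.
rewrite ![l2 == l1]eq_sym ![l3 == l1]eq_sym ![l3 == l2]eq_sym.
rewrite (negPf n01) (negPf n02) (negPf n03) (negPf n12) (negPf n13) (negPf n23).
rewrite !mulr0 !mulr1 !addr0 !add0r => e0 e1 e2 e3; apply/quatP.
by split=> //; [apply: (mulIf a1N0)|apply: (mulIf a2N0)|apply: (mulIf a3N0)].
Qed.

(** The signs chosen under the square roots make the factors nonzero in each
    case. *)
Lemma mapF_monomial (R : realType) (g1 g2 : R) : g1 != 0 -> g2 != 0 ->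
  exists (l1 l2 l3 : 'I_4) (a1 a2 a3 : R),
    [/\ uniq [:: 0; l1; l2; l3], [&& a1 != 0, a2 != 0 & a3 != 0] &
        @mapF R g1 g2 = qcomb (a1 *: qe l1) (a2 *: qe l2) (a3 *: qe l3)].
Proof.
have sqrtN0 (t : R) : 0 < t -> Num.sqrt t != 0.
  by move=> t0; rewrite gt_eqF // sqrtr_gt0.
move=> g1N0 g2N0; rewrite /mapF /target_sign.
case: (boolP ((0 < g1) && (0 < g2))) => [/andP[p1 p2]|npp].
  exists 1, 2, 3, (Num.sqrt g1), (Num.sqrt g2), (Num.sqrt (g1 * g2)).
  by split=> //; rewrite !sqrtN0 // mulr_gt0.
case: (boolP ((g1 < 0) && (g2 < 0))) => [/andP[n1 n2]|nnn].
  exists 3, 2, 1, (Num.sqrt (- g1)), (Num.sqrt (- g2)), (Num.sqrt (g1 * g2)).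
  by split=> //; rewrite !sqrtN0 ?oppr_gt0 // nmulr_rgt0.
case: (ltgtP 0 g1) npp nnn g1N0 => [p1|n1|//].
- rewrite /= -leNgt le_eqVlt (negPf g2N0) /= => n2 _ _.
  exists 1, 2, 3, (Num.sqrt g1), (Num.sqrt (- g2)), (Num.sqrt (- (g1 * g2))).
  by split=> //; rewrite !sqrtN0 ?oppr_gt0 // pmulr_rlt0.
- rewrite /= -leNgt le_eqVlt eq_sym (negPf g2N0) /= => _ p2 _.
  exists 3, 1, 2, (Num.sqrt (- g1)), (Num.sqrt g2), (Num.sqrt (- (g1 * g2))).
  by split=> //; rewrite !sqrtN0 ?oppr_gt0 // nmulr_rlt0.
Qed.

Lemma mapF_inj (R : realType) (g1 g2 : R) : g1 != 0 -> g2 != 0 ->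
  injective (@mapF R g1 g2).
Proof.
move=> g1N0 g2N0.
have [l1 [l2 [l3 [a1 [a2 [a3 [ul aN0 ->]]]]]]] := mapF_monomial _ _ _ g1N0 g2N0.
exact: qcomb_monomial_inj.
Qed.

Lemma mapF_basis (R : realType) (g1 g2 : R) : g1 != 0 -> g2 != 0 ->
  @mapF R g1 g2 = qcomb (mapF (qe 1)) (mapF (qe 2)) (mapF (qe 3)).
Proof.
move=> g1N0 g2N0.
have [l1 [l2 [l3 [a1 [a2 [a3 [_ _ ->]]]]]]] := mapF_monomial _ _ _ g1N0 g2N0.
by have [-> -> ->] := @qcomb_qe R g1 g2 1 (target_sign g1 g2)
  (a1 *: qe l1) (a2 *: qe l2) (a3 *: qe l3).
Qed.

(** Injectivity of [mapF] makes [pinv setT mapF] a left inverse, so the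
    components of [f] are evaluated at [x]; what remains is the expansion of
    [mapF (f x)] along the images of the basis. *)
Lemma frakF_mapF (R : realType) (g1 g2 : R) (f : quat g1 g2 -> quat g1 g2) x :
  g1 != 0 -> g2 != 0 -> frakF f (mapF x) = mapF (f x).
Proof.
move=> g1N0 g2N0; rewrite /frakF pinvKV ?inE //; last first.
  by move=> y z _ _; apply: mapF_inj.
by rewrite [in RHS]mapF_basis.
Qed.

Theorem theorem3p1 (R : realType) (g1 g2 : R) (hg1 : g1 != 0) (hg2 : g2 != 0)
    (f : quat g1 g2 -> quat g1 g2) (hf : continuous f) (x0 : quat g1 g2) :
  (f x0 = 0 -> frakF f (mapF x0) = 0) /\
  (frakF f (mapF x0) = 0 -> f x0 = 0).
Proof.
have mapF0 : mapF (0 : quat g1 g2) = 0 by rewrite mapF_basis // qcomb0.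
rewrite frakF_mapF //; split=> [->//|mapFfx0].
by apply: (mapF_inj _ _ _ hg1 hg2); rewrite mapF0.
Qed.
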